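(* Let $\mathbf x$ be an extreme point of a 0/1-LP $\min\{\mathbf c^{\intercal}\mathbf x: A\mathbf x=\mathbf b,\ B\mathbf x\le\mathbf d,\ \mathbf x\in\mathbb R^n\}$ with $n$ variables. Then a maximal augmentation at $\mathbf x$ along a steepest edge is an $n$-approximate greatest-improvement augmentation at $\mathbf x$.
   Context: A 0/1-LP is an LP whose feasible region $\mathcal P$ is a 0/1 polytope (all vertices in $\{0,1\}^n$). Standing assumptions: $A,B,\mathbf b,\mathbf d,\mathbf c$ integral, $A$ of full row rank, $\binom{A}{B}$ of rank $n$. Circuits: nonzero $\mathbf g\in\ker(A)$ with $B\mathbf g$ support-minimal in $\{B\mathbf y:\mathbf y\in\ker A,\mathbf y\ne\mathbf 0\}$; $\mathcal C(A,B)$ is the set of circuits with co-prime integer components. The edge-directions at a vertex $\mathbf x$ are the extreme rays of the feasible cone $\{\mathbf z: A\mathbf z=\mathbf 0,\ B_T\mathbf z\le\mathbf 0\}$, $T$ the indices of inequalities tight at $\mathbf x$; a steepest edge is an edge-direction $\mathbf g$ minimizing $\mathbf c^{\intercal}\mathbf g/\|\mathbf g\|_1$. A maximal augmentation along $\mathbf g$ is $\alpha\mathbf g$ with $\alpha>0$ largest such that $\mathbf x+\alpha\mathbf g\in\mathcal P$. A greatest-improvement augmentation $\alpha^*\mathbf g^*$ maximizes $-\mathbf c^{\intercal}(\alpha\mathbf g)$ over $\mathbf g\in\mathcal C(A,B)$, $\alpha>0$, $\mathbf x+\alpha\mathbf g\in\mathcal P$; an augmentation $\alpha\mathbf g$ is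 $\gamma$-approximate greatest-improvement if $\mathbf c^{\intercal}\mathbf x-\mathbf c^{\intercal}(\mathbf x+\alpha\mathbf g)\ge\frac1\gamma(\mathbf c^{\intercal}\mathbf x-\mathbf c^{\intercal}(\mathbf x+\alpha^*\mathbf g^* ))$. *)

(* Defs.v *)
From mathcomp Require Import all_boot all_order all_algebra.
From mathcomp Require Import classical_sets reals.

Set Implicit Arguments.
Unset Strict Implicit.
Unset Printing Implicit Defensive.

Import Order.TTheory GRing.Theory Num.Theory.

Local Open Scope classical_set_scope.
Local Open Scope ring_scope.

(* The data A, B, b, d, c are integral; they act on R^n through [map_mx intr]. *)

Definition polyhedron (R : realType) (m p n : nat)
    (A : 'M[int]_(m, n)) (B : 'M[int]_(p, n)) (b : 'cV[int]_m) (d : 'cV[int]_p)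
    : set 'cV[R]_n :=
  [set x | map_mx intr A *m x = map_mx intr b
         /\ forall i, (map_mx intr B *m x) i 0 <= (d i 0)%:~R].

Definition objective (R : realType) (n : nat) (c : 'cV[int]_n) (x : 'cV[R]_n) : R :=
  ((map_mx intr c)^T *m x) 0 0.

Definition norm1 (R : realType) (n : nat) (v : 'cV[R]_n) : R :=
  \sum_(i < n) `|v i 0|.

Definition extreme_point (R : realType) (n : nat) (P : set 'cV[R]_n)
    (x : 'cV[R]_n) : Prop :=
  P x /\ forall (y z : 'cV[R]_n) (t : R), P y -> P z -> 0 < t < 1 ->
    x = t *: y + (1 - t) *: z -> y = x /\ z = x.

Definition bounded_region (R : realType) (n : nat) (P : set 'cV[R]_n) : Prop :=
  exists M : R, forall x, P x -> forall i, `|x i 0| <= M.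

(* To be applied to a polyhedron: a polytope is a bounded polyhedron, and its
   vertices are its extreme points. *)
Definition zero_one_polytope (R : realType) (n : nat) (P : set 'cV[R]_n) : Prop :=
  bounded_region P /\
  forall v, extreme_point P v -> forall i, v i 0 = 0 \/ v i 0 = 1.

Definition supp (R : realType) (p : nat) (v : 'cV[R]_p) : {set 'I_p} :=
  [set i | v i 0 != 0]%SET.

Definition circuit (R : realType) (m p n : nat)
    (A : 'M[int]_(m, n)) (B : 'M[int]_(p, n)) (g : 'cV[R]_n) : Prop :=
  [/\ g != 0, map_mx intr A *m g = 0 &
      forall y : 'cV[R]_n, y != 0 -> map_mx intr A *m y = 0 ->
        ~~ (supp (map_mx intr B *m y) \proper supp (map_mx intr B *m g))].

Definition circuits (R : realType) (m p n : nat)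
    (A : 'M[int]_(m, n)) (B : 'M[int]_(p, n)) : set 'cV[R]_n :=
  [set g | circuit A B g /\
     exists z : 'cV[int]_n,
       g = map_mx intr z /\ \big[gcdn/0%N]_(i < n) absz (z i 0%R) = 1%N].

Definition feasible_cone (R : realType) (m p n : nat)
    (A : 'M[int]_(m, n)) (B : 'M[int]_(p, n)) (d : 'cV[int]_p)
    (x : 'cV[R]_n) : set 'cV[R]_n :=
  [set z | map_mx intr A *m z = 0
         /\ forall i, (map_mx intr B *m x) i 0 = (d i 0)%:~R ->
                      (map_mx intr B *m z) i 0 <= 0].

(* g generates an extreme ray of the cone K. *)
Definition extreme_ray (R : realType) (n : nat) (K : set 'cV[R]_n)
    (g : 'cV[R]_n) : Prop :=
  [/\ K g, g != 0 &
      forall y z : 'cV[R]_n, K y -> K z -> g = y + z ->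
        exists s t : R, [/\ 0 <= s, 0 <= t, y = s *: g & z = t *: g]].

Definition edge_direction (R : realType) (m p n : nat)
    (A : 'M[int]_(m, n)) (B : 'M[int]_(p, n)) (d : 'cV[int]_p)
    (x g : 'cV[R]_n) : Prop :=
  extreme_ray (feasible_cone A B d x) g.

(* The slope is invariant under positive scaling, so edge-directions need not be
   normalized. *)
Definition steepest_edge (R : realType) (m p n : nat)
    (A : 'M[int]_(m, n)) (B : 'M[int]_(p, n)) (d : 'cV[int]_p) (c : 'cV[int]_n)
    (x g : 'cV[R]_n) : Prop :=
  edge_direction A B d x g /\
  forall h, edge_direction A B d x h ->
    objective c g / norm1 g <= objective c h / norm1 h.

Definition maximal_step (R : realType) (n : nat) (P : set 'cV[R]_n)
    (x g : 'cV[R]_n) (alpha : R) : Prop :=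
  [/\ 0 < alpha, P (x + alpha *: g) &
      forall beta, 0 < beta -> P (x + beta *: g) -> beta <= alpha].

Definition circuit_step (R : realType) (m p n : nat)
    (A : 'M[int]_(m, n)) (B : 'M[int]_(p, n)) (b : 'cV[int]_m) (d : 'cV[int]_p)
    (x g : 'cV[R]_n) (alpha : R) : Prop :=
  [/\ circuits A B g, 0 < alpha & polyhedron A B b d (x + alpha *: g)].

Definition greatest_improvement (R : realType) (m p n : nat)
    (A : 'M[int]_(m, n)) (B : 'M[int]_(p, n)) (b : 'cV[int]_m) (d : 'cV[int]_p)
    (c : 'cV[int]_n) (x g : 'cV[R]_n) (alpha : R) : Prop :=
  circuit_step A B b d x g alpha /\
  forall h beta, circuit_step A B b d x h beta ->
    - objective c (beta *: h) <= - objective c (alpha *: g).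

(* The displacement v = alpha *: g is what matters: the scalar alpha depends on
   the normalization of g, hence the existential.  If x is the unique optimum,
   the supremum 0 of the improvements is not attained, there is no
   greatest-improvement augmentation, and the comparison is void. *)
Definition approx_greatest_improvement (R : realType) (m p n : nat)
    (A : 'M[int]_(m, n)) (B : 'M[int]_(p, n)) (b : 'cV[int]_m) (d : 'cV[int]_p)
    (c : 'cV[int]_n) (gamma : R) (x v : 'cV[R]_n) : Prop :=
  (exists g alpha, circuit_step A B b d x g alpha /\ v = alpha *: g) /\
  forall gs alphas, greatest_improvement A B b d c x gs alphas ->
    objective c x - objective c (x + v) >=
      gamma^-1 * (objective c x - objective c (x + alphas *: gs)).

(* Main.v *)
(* The 1-norm is linear on the feasible cone K of a vertex x of a 0/1 polytope,
   because the sign of each coordinate of a feasible direction is determined by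
   the corresponding coordinate of x.  Hence the slice {z in K, norm1 z = 1} is a
   polytope whose vertices generate the extreme rays of K, and the inequality
   c^T h >= sigma * norm1 h, which for sigma the slope of a steepest edge g holds
   on the edge-directions, extends to all of K.  A maximal step v along g ends at
   a vertex, so v has entries in {-1, 0, 1} and norm1 v >= 1, whereas every
   feasible displacement w satisfies norm1 w <= n; therefore
   - c^T w <= - sigma * n <= n * (- c^T v) when sigma <= 0.  When sigma > 0 no
   greatest-improvement augmentation exists. *)
Require Import Defs.
From mathcomp Require Import all_boot all_order all_algebra.
From mathcomp Require Import boolp classical_sets reals.
From mathcomp Require Import ring lra.

Import Order.TTheory GRing.Theory Num.Theory.

Local Open Scope ring_scope.

Set Implicit Arguments.
Unset Strict Implicit.

(** * Vertices of bounded polyhedra *)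

(** Real data let one vertex lemma serve both [polyhedron] and the normalized slice of a feasible
    cone. *)
Definition hpolyhedron (R : realType) (k p n : nat) (E : 'M[R]_(k, n))
    (G : 'M[R]_(p, n)) (e : 'cV[R]_k) (h : 'cV[R]_p) : set 'cV[R]_n :=
  [set x | E *m x = e /\ forall i, (G *m x) i 0 <= h i 0]%classic.

Lemma polyhedronE (R : realType) (m p n : nat) (A : 'M[int]_(m, n))
    (B : 'M[int]_(p, n)) (b : 'cV[int]_m) (d : 'cV[int]_p) :
  polyhedron A B b d =
  hpolyhedron (R := R) (map_mx intr A) (map_mx intr B) (map_mx intr b)
    (map_mx intr d).
Proof.
by apply/seteqP; split=> x [Ax Bx]; split=> // i; move: (Bx i); rewrite !mxE.
Qed.

Lemma mulmx_line (R : realType) (k n : nat) (M : 'M[R]_(k, n)) (x u : 'cV[R]_n)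
    (t : R) i :
  (M *m (x + t *: u)) i 0 = (M *m x) i 0 + t * (M *m u) i 0.
Proof. by rewrite mulmxDr -scalemxAr !mxE. Qed.

(** An inequality tight at a point strictly between [y] and [z] is tight at both, so it vanishes on
    [y - z], and the triviality hypothesis applies. *)
Lemma extreme_point_tight (R : realType) (k p n : nat) (E : 'M[R]_(k, n))
    (G : 'M[R]_(p, n)) (e : 'cV[R]_k) (h : 'cV[R]_p) (x : 'cV[R]_n) :
  hpolyhedron E G e h x ->
  (forall u : 'cV[R]_n, E *m u = 0 ->
     (forall i, (G *m x) i 0 = h i 0 -> (G *m u) i 0 = 0) -> u = 0) ->
  extreme_point (hpolyhedron E G e h) x.
Proof.
move=> Px triv; split=> // y z t [Ey Gy] [Ez Gz] /andP[t0 t1] xE.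
have /triv Eyz : E *m (y - z) = 0 by rewrite mulmxBr Ey Ez subrr.
have /Eyz/eqP : forall i, (G *m x) i 0 = h i 0 -> (G *m (y - z)) i 0 = 0.
  move=> i; rewrite xE mulmxDr -!scalemxAr mulmxBr.
  move: (Gy i) (Gz i); rewrite !mxE => Gyi Gzi tight.
  have [Gyh Gzh] : (G *m y) i 0 = h i 0 /\ (G *m z) i 0 = h i 0.
    rewrite !mxE; split; nra.
  by move: Gyh Gzh; rewrite !mxE => -> ->; rewrite subrr.
rewrite subr_eq0 => /eqP yzE.
by rewrite xE yzE -scalerDl addrC subrK scale1r.
Qed.

(* While x is not a vertex, a line through x keeps every tight inequality tight;
   moving along it in the direction in which f does not decrease, until blocked,
   makes one more inequality tight. *)
Lemma vertex_ge (R : realType) (k p n : nat) (E : 'M[R]_(k, n))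
    (G : 'M[R]_(p, n)) (e : 'cV[R]_k) (h : 'cV[R]_p) (f : 'rV[R]_n)
    (x : 'cV[R]_n) :
  bounded_region (hpolyhedron E G e h) -> hpolyhedron E G e h x ->
  exists2 v, extreme_point (hpolyhedron E G e h) v &
    (f *m x) 0 0 <= (f *m v) 0 0.
Proof.
move=> [M bM].
pose slack (y : 'cV[R]_n) := [set i | (G *m y) i 0 != h i 0]%SET.
have [N] := ubnP #|slack x|.
elim: N x => // N IHN x; rewrite ltnS => leN Px.
have [[u [u0 Eu Gu]]|noline] := pselect (exists u : 'cV[R]_n,
  [/\ u != 0, E *m u = 0 &
    forall i, (G *m x) i 0 = h i 0 -> (G *m u) i 0 = 0]); last first.
  exists x => //; apply: extreme_point_tight => // u Eu Gu.
  by apply: contrapT => /eqP u0; apply: noline; exists u.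
wlog fu : u u0 Eu Gu / 0 <= (f *m u) 0 0.
  move=> W; have [|fu] := leP 0 ((f *m u) 0 0); first exact: (W u).
  apply: (W (- u)); rewrite ?oppr_eq0 ?mulmxN ?Eu ?oppr0 //.
    by move=> i /Gu Gui; rewrite mxE Gui oppr0.
  by rewrite mxE oppr_ge0 ltW.
have [Ex Gx] := Px.
have Eline t : E *m (x + t *: u) = e.
  by rewrite mulmxDr -scalemxAr Eu scaler0 addr0.
(* Without a blocking inequality the region would contain a whole ray. *)
have [i0 Gi0] : exists i, 0 < (G *m u) i 0.
  apply: contrapT => noblock.
  have Pline t : 0 <= t -> hpolyhedron E G e h (x + t *: u).
    move=> t0; split=> // i; rewrite mulmx_line (le_trans _ (Gx i)) //.
    rewrite gerDl mulr_ge0_le0 // leNgt; apply/negP => Gi.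
    by apply: noblock; exists i.
  have [j uj] : exists j, u j 0 != 0.
    apply: contrapT => uj; case/negP: u0; apply/eqP/colP => j; rewrite mxE.
    by apply: contrapT => /eqP ?; apply: uj; exists j.
  have uj0 : 0 < `|u j 0| by rewrite normr_gt0.
  have M0 : 0 <= M by apply: le_trans (bM _ Px j).
  (* Coordinate [j] moves by 2M + 1, but two points of the region differ there by at most 2M. *)
  pose t := (M + M + 1) / `|u j 0|.
  have t0 : 0 <= t by rewrite divr_ge0 // !addr_ge0.
  have := bM _ (Pline _ t0) j; have := bM _ Px j; rewrite !mxE.
  have tu : `|t * u j 0| = M + M + 1.
    by rewrite normrM ger0_norm // divfK ?gt_eqF.
  have := ler_normB (x j 0 + t * u j 0) (x j 0).
  by rewrite addrAC subrr add0r tu; lra.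
(* Ratio test of the simplex method: the inequality of smallest [ratio] blocks first. *)
pose ratio i := (h i 0 - (G *m x) i 0) / (G *m u) i 0.
case: (@arg_minP _ _ _ i0 (fun i => 0 < (G *m u) i 0) ratio Gi0) => i Gi imin.
have r0 : 0 <= ratio i by rewrite divr_ge0 ?subr_ge0 // ltW.
have Py : hpolyhedron E G e h (x + ratio i *: u).
  split=> // j; rewrite mulmx_line.
  have [Gj|Gj] := ltP 0 ((G *m u) j 0).
    by rewrite addrC -lerBrDr -ler_pdivlMr //; exact: imin.
  by rewrite (le_trans _ (Gx j)) // gerDl mulr_ge0_le0.
have [|v vext fv] := IHN (x + ratio i *: u) _ Py.
  apply: leq_trans leN; apply: proper_card; apply/properP; split.
    apply/fintype.subsetP => j; rewrite !inE mulmx_line.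
    apply: contra => /eqP Gj.
    by rewrite Gu // mulr0 addr0 Gj.
  exists i; rewrite !inE; last first.
    by rewrite mulmx_line divfK ?(gt_eqF Gi) // addrC subrK eqxx.
  by apply/eqP => /Gu Gi'; rewrite Gi' ltxx in Gi.
exists v => //; apply: le_trans fv.
by rewrite mulmx_line lerDl mulr_ge0.
Qed.

(** The inverse of 1 plus the sum of all |b i| / a i works for every i at once, even when the sum is
    empty or zero. *)
Lemma small_step (R : realType) (I : finType) (a b : I -> R) :
  (forall i, 0 < a i) -> exists2 t, 0 < t & forall i, t * `|b i| <= a i.
Proof.
move=> a0; pose S := \sum_i `|b i| / a i.
have ba0 i : 0 <= `|b i| / a i by rewrite divr_ge0 // ltW.
have S0 : 0 < 1 + S by rewrite ltr_pwDl // sumr_ge0.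
exists (1 + S)^-1; first by rewrite invr_gt0.
move=> i; rewrite mulrC ler_pdivrMr // mulrC -ler_pdivrMr //.
by rewrite /S (bigD1 i) //= addrCA lerDl addr_ge0 // sumr_ge0.
Qed.

Lemma objective_line (R : realType) (n : nat) (c : 'cV[int]_n)
    (x u : 'cV[R]_n) (t : R) :
  objective c (x + t *: u) = objective c x + t * objective c u.
Proof. exact: mulmx_line. Qed.

Lemma objectiveZ (R : realType) (n : nat) (c : 'cV[int]_n) (u : 'cV[R]_n)
    (t : R) :
  objective c (t *: u) = t * objective c u.
Proof. by rewrite /objective -scalemxAr mxE. Qed.

Lemma norm1_ge0 (R : realType) (n : nat) (v : 'cV[R]_n) : 0 <= norm1 v.
Proof. exact: sumr_ge0. Qed.

Lemma norm1_eq0 (R : realType) (n : nat) (v : 'cV[R]_n) : norm1 v = 0 -> v = 0.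
Proof.
move=> /eqP; rewrite psumr_eq0 // => /allP v0; apply/colP => i.
by apply/eqP; rewrite mxE -normr_eq0; apply: v0; rewrite mem_index_enum.
Qed.

Lemma norm1_gt0 (R : realType) (n : nat) (v : 'cV[R]_n) :
  v != 0 -> 0 < norm1 v.
Proof.
move=> v0; rewrite lt_neqAle norm1_ge0 andbT eq_sym.
by apply: contra_neq v0; exact: norm1_eq0.
Qed.

Lemma norm1Z (R : realType) (n : nat) (v : 'cV[R]_n) (t : R) :
  norm1 (t *: v) = `|t| * norm1 v.
Proof.
by rewrite /norm1 mulr_sumr; apply: eq_bigr => i _; rewrite mxE normrM.
Qed.

(** * The feasible cone and its edge-directions *)

Lemma feasible_coneZ (R : realType) (m p n : nat) (A : 'M[int]_(m, n))
    (B : 'M[int]_(p, n)) (d : 'cV[int]_p) (x z : 'cV[R]_n) (t : R) :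
  0 <= t -> feasible_cone A B d x z -> feasible_cone A B d x (t *: z).
Proof.
move=> t0 [Az Bz]; split=> [|i /Bz Bzi]; first by rewrite -scalemxAr Az scaler0.
by rewrite -scalemxAr mxE mulr_ge0_le0.
Qed.

Lemma feasible_cone_sub (R : realType) (m p n : nat) (A : 'M[int]_(m, n))
    (B : 'M[int]_(p, n)) (b : 'cV[int]_m) (d : 'cV[int]_p) (x y : 'cV[R]_n) :
  polyhedron A B b d x -> polyhedron A B b d y ->
  feasible_cone A B d x (y - x).
Proof.
move=> [Ax _] [Ay By]; split=> [|i tight]; first by rewrite mulmxBr Ax Ay subrr.
rewrite mulmxBr [X in X <= _]mxE [X in _ + X]mxE tight.
by rewrite subr_le0.
Qed.

Lemma feasible_cone_step (R : realType) (m p n : nat) (A : 'M[int]_(m, n))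
    (B : 'M[int]_(p, n)) (b : 'cV[int]_m) (d : 'cV[int]_p) (x z : 'cV[R]_n) :
  polyhedron A B b d x -> feasible_cone A B d x z ->
  exists2 t, 0 < t & polyhedron A B b d (x + t *: z).
Proof.
move=> [Ax Bx] [Az Bz].
pose Bxi i := (map_mx intr B *m x) i 0.
(* The bound 1 is a placeholder at tight inequalities, which the cone condition handles. *)
have [i|t t0 tB] := @small_step _ _
    (fun i => if Bxi i == (d i 0)%:~R then 1 else (d i 0)%:~R - Bxi i)
    (fun i => (map_mx intr B *m z) i 0).
  by case: ifPn => // ne; rewrite subr_gt0 lt_neqAle ne Bx.
exists t => //; split=> [|i].
  by rewrite mulmxDr -scalemxAr Az scaler0 addr0.
rewrite mulmx_line; move: (tB i); case: ifPn => [/eqP tight _|_ tBi].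
  by rewrite (le_trans _ (Bx i)) // gerDl mulr_ge0_le0 ?(ltW t0) ?Bz.
rewrite addrC -lerBrDr; apply: le_trans tBi.
by rewrite ler_pM2l // ler_norm.
Qed.

(* A direction y whose support contradicts the minimality of g would put
   g + t y and g - t y in the cone for small t, making y a multiple of g. *)
Lemma edge_direction_circuit (R : realType) (m p n : nat) (A : 'M[int]_(m, n))
    (B : 'M[int]_(p, n)) (d : 'cV[int]_p) (x g : 'cV[R]_n) :
  edge_direction A B d x g -> circuit A B g.
Proof.
move=> [[Ag Bg] g0 gext]; split=> // y y0 Ay; apply/negP => /properP[sub].
case=> i; rewrite !inE => gi yi.
pose Bgi i := (map_mx intr B *m g) i 0.
have [j|t t0 tB] := @small_step _ _
    (fun i => if Bgi i == 0 then 1 else `|Bgi i|)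
    (fun i => (map_mx intr B *m y) i 0).
  by case: ifPn => // ne; rewrite normr_gt0.
have K s : `|s| = t -> feasible_cone A B d x (g + s *: y).
  move=> st; split=> [|j tight].
    by rewrite mulmxDr -scalemxAr Ag Ay scaler0 addr0.
  rewrite mulmx_line; move: (tB j) (Bg j tight) (fintype.subsetP sub j).
  rewrite -st -normrM !inE -/(Bgi j); case: eqP => [->|_ + Bgj _].
    move=> _ _ /implyP; rewrite /= implybF negbK => /eqP->.
    by rewrite mulr0 addr0.
  by rewrite (ler0_norm Bgj) => /ler_normlP[]; lra.
have K2 s : `|s| = t -> feasible_cone A B d x (2^-1 *: (g + s *: y)).
  by move=> st; apply: feasible_coneZ; [rewrite invr_ge0 | exact: K].
have gE : g = 2^-1 *: (g + t *: y) + 2^-1 *: (g + (- t) *: y).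
  by apply/colP => j; rewrite !mxE; field.
have [||r [_ [_ _ rE _]]] := gext _ _ (K2 t _) (K2 (- t) _) gE.
- by rewrite gtr0_norm.
- by rewrite normrN gtr0_norm.
have yE : y = ((2 * r - 1) / t) *: g.
  apply/colP => j; move/colP/(_ j): rE; rewrite !mxE => rj.
  apply: (mulfI (lt0r_neq0 t0)); rewrite mulrA mulrCA divff ?gt_eqF // mulr1.
  by move: rj; lra.
(* At [i], [B g] is nonzero and [B y] is zero, so the factor in [yE] is zero. *)
move: yi y0; rewrite yE -scalemxAr mxE negbK mulf_eq0 (negbTE gi) orbF.
by move=> /eqP->; rewrite scale0r eqxx.
Qed.

(** If the endpoint lies strictly between feasible [y] and [z], then [g] is a positive combination
    of [y - x] and [z - x], so both lie on the ray of [g]. Neither can pass the maximal step, so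
    both are the endpoint. *)
Lemma maximal_step_edge_extreme (R : realType) (m p n : nat)
    (A : 'M[int]_(m, n)) (B : 'M[int]_(p, n)) (b : 'cV[int]_m) (d : 'cV[int]_p)
    (x g : 'cV[R]_n) (alpha : R) :
  polyhedron A B b d x -> edge_direction A B d x g ->
  maximal_step (polyhedron A B b d) x g alpha ->
  extreme_point (polyhedron A B b d) (x + alpha *: g).
Proof.
move=> Px [_ g0 gext] [a0 Pa amax]; split=> // y z t Py Pz /andP[t0 t1] xE.
have gE : g = (t / alpha) *: (y - x) + ((1 - t) / alpha) *: (z - x).
  apply: (scalerI (lt0r_neq0 a0)); rewrite scalerDr !scalerA.
  rewrite ![alpha * (_ / _)]mulrCA divff ?gt_eqF // !mulr1.
  apply: (addrI x); rewrite xE; apply/colP => j; rewrite !mxE; ring.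
have t1' : 0 < 1 - t by rewrite subr_gt0.
have [||r [s [r0 s0 rE sE]]] := gext _ _ _ _ gE.
- by apply: feasible_coneZ; [rewrite divr_ge0 // ltW |
    exact: feasible_cone_sub Px Py].
- by apply: feasible_coneZ; [rewrite divr_ge0 // ltW |
    exact: feasible_cone_sub Px Pz].
have line w q k : 0 < q -> 0 <= k -> polyhedron A B b d w ->
    q *: (w - x) = k *: g -> w = x + (k / q) *: g /\ k <= alpha * q.
  move=> q0 k0 Pw wE; have {}wE : w = x + (k / q) *: g.
    by rewrite mulrC -scalerA -wE scalerA mulVf ?gt_eqF // scale1r addrC subrK.
  split=> //; rewrite -ler_pdivrMr //; have [kq|kq] := ltP 0 (k / q).
    by apply: amax => //; rewrite -wE.
  exact: le_trans kq (ltW a0).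
have [yE ra] := line y _ _ (divr_gt0 t0 a0) r0 Py rE.
have [zE sa] := line z _ _ (divr_gt0 t1' a0) s0 Pz sE.
(* Maximality gives r <= t and s <= 1 - t; a total of 1 turns both into equalities. *)
have rs1 : r + s = 1.
  apply/eqP; rewrite -subr_eq0; apply/eqP; apply: contra_neq_eq g0 => rs.
  apply: (scalerI rs).
  by rewrite scaler0 scalerBl scalerDl -rE -sE -gE scale1r subrr.
move: ra sa; rewrite ![alpha * (_ / _)]mulrCA divff ?gt_eqF // !mulr1 => rt st.
have rE' : r = t by lra.
have sE' : s = 1 - t by lra.
rewrite yE zE rE' sE' !invf_div !mulrA.
by rewrite ![_ * alpha]mulrC !mulfK ?gt_eqF.
Qed.

(** * The 1-norm and the slope on the feasible cone of a vertex *)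

(** A coordinate and its negative are both dominated by their values at vertices. *)
Lemma zero_one_polytope_bounds (R : realType) (m p n : nat) (A : 'M[int]_(m, n))
    (B : 'M[int]_(p, n)) (b : 'cV[int]_m) (d : 'cV[int]_p) (y : 'cV[R]_n) i :
  zero_one_polytope (@polyhedron R m p n A B b d) -> polyhedron A B b d y ->
  0 <= y i 0 <= 1.
Proof.
move=> [bP vP] Py; rewrite polyhedronE in bP vP Py.
have coord (w : 'cV[R]_n) : ((delta_mx 0 i : 'rV_n) *m w) 0 0 = w i 0.
  by rewrite -rowE mxE.
have [v /vP/(_ i) vi yv] := vertex_ge (delta_mx 0 i) bP Py.
have [w /vP/(_ i) wi yw] := vertex_ge (- delta_mx 0 i) bP Py.
move: yv yw; rewrite !mulNmx ![(- (_ : matrix _ _ _)) _ _]mxE !coord lerN2.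
by move: vi wi => [->|->] [->|->]; lra.
Qed.

(** A feasible direction can only raise a coordinate that is 0 and lower one that is 1; 1 - 2 x_j is
    the corresponding sign. *)
Lemma norm1_feasible_cone (R : realType) (m p n : nat) (A : 'M[int]_(m, n))
    (B : 'M[int]_(p, n)) (b : 'cV[int]_m) (d : 'cV[int]_p) (x z : 'cV[R]_n) :
  zero_one_polytope (@polyhedron R m p n A B b d) ->
  extreme_point (polyhedron A B b d) x -> feasible_cone A B d x z ->
  norm1 z = ((\row_j (1 - 2 * x j 0)) *m z) 0 0.
Proof.
move=> P01 xext Kz; have [t t0 Pt] := feasible_cone_step xext.1 Kz.
rewrite mxE; apply: eq_bigr => i _; rewrite mxE.
have := zero_one_polytope_bounds i P01 Pt; rewrite !mxE => /andP[tz0 tz1].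
have [xi|xi] := P01.2 _ xext i; move: tz0 tz1; rewrite xi.
  by rewrite add0r pmulr_rge0 // => z0 _; rewrite ger0_norm //; ring.
rewrite gerDl pmulr_rle0 // => _ z0; rewrite ler0_norm //; ring.
Qed.

(* If the 1-norm is linear on the cone, its slice [norm1 = 1] is a polytope
   whose vertices are generators of the extreme rays. *)
Lemma feasible_cone_ge0 (R : realType) (m p n : nat) (A : 'M[int]_(m, n))
    (B : 'M[int]_(p, n)) (d : 'cV[int]_p) (x : 'cV[R]_n) (s f : 'rV[R]_n) :
  (forall z, feasible_cone A B d x z -> norm1 z = (s *m z) 0 0) ->
  (forall h, edge_direction A B d x h -> 0 <= (f *m h) 0 0) ->
  forall z, feasible_cone A B d x z -> 0 <= (f *m z) 0 0.
Proof.
move=> sK f0 z Kz.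
pose tight i := (map_mx intr B *m x) i 0 == (d i 0)%:~R.
(* Rows of non-tight inequalities are zeroed, so they only state 0 <= 0. *)
pose G : 'M[R]_(p, n) := \matrix_(i, j) (if tight i then (B i j)%:~R else 0).
have GE (w : 'cV[R]_n) i :
    (G *m w) i 0 = if tight i then (map_mx intr B *m w) i 0 else 0.
  rewrite !mxE; case: ifP => ti; last first.
    by apply: big1 => j _; rewrite mxE ti mul0r.
  by apply: eq_bigr => j _; rewrite !mxE ti.
pose Q := hpolyhedron (col_mx (map_mx intr A) s) G (col_mx 0 1) 0.
have QE w : Q w <-> feasible_cone A B d x w /\ norm1 w = 1.
  have Gw : (forall i, (G *m w) i 0 <= (0 : 'cV_p) i 0) <->
      (forall i, (map_mx intr B *m x) i 0 = (d i 0)%:~R ->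
        (map_mx intr B *m w) i 0 <= 0).
    split=> Gw i; have := Gw i; rewrite GE [(0 : matrix _ _ _) i 0]mxE /tight.
      by move=> + tE; rewrite tE eqxx.
    by case: eqP => [tE|] // Bw; exact: Bw.
  split=> [[/eqP + /Gw Bw]|[[Aw Bw] w1]].
    rewrite mul_col_mx => /eqP/eq_col_mx[Aw sw]; split=> //.
    by rewrite sK // sw mxE.
  split; last exact/Gw; rewrite mul_col_mx Aw; congr col_mx.
  by apply/matrixP => i j; rewrite !ord1 -sK // w1 mxE.
have bQ : bounded_region Q.
  exists 1 => w /QE[_ w1] i; rewrite -w1 /norm1 (bigD1 i) //= lerDl.
  exact: sumr_ge0.
have [->|z0] := eqVneq z 0; first by rewrite mulmx0 mxE.
have nz0 := norm1_gt0 z0.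
have Qz : Q ((norm1 z)^-1 *: z).
  apply/QE; split; first by apply: feasible_coneZ; rewrite // invr_ge0 ltW.
  by rewrite norm1Z gtr0_norm ?invr_gt0 // mulVf ?gt_eqF.
(* [vertex_ge] does not decrease its functional, so [- f] yields a vertex where [f] is no larger. *)
have [v [/QE[Kv v1] vext]] := vertex_ge (- f) bQ Qz.
rewrite !mulNmx ![(- (_ : matrix _ _ _)) _ _]mxE lerN2 -scalemxAr.
rewrite [X in _ <= X]mxE => fv.
rewrite -(pmulr_rge0 _ (_ : 0 < (norm1 z)^-1)) ?invr_gt0 //.
apply: le_trans fv; apply: f0; split=> //.
  apply/eqP => v0; move/eqP: v1.
  by rewrite v0 -(scale0r (0 : 'cV[R]_n)) norm1Z normr0 mul0r eq_sym oner_eq0.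
move=> y w Ky Kw vE.
have yw1 : norm1 y + norm1 w = 1.
  by rewrite -v1 !sK // vE mulmxDr [RHS]mxE.
have [y0|y0] := eqVneq (norm1 y) 0.
  exists 0, 1; split; rewrite // ?scale0r ?scale1r; first exact: norm1_eq0.
  by rewrite vE (norm1_eq0 y0) add0r.
have [w0|w0] := eqVneq (norm1 w) 0.
  exists 1, 0; split; rewrite // ?scale0r ?scale1r; last exact: norm1_eq0.
  by rewrite vE (norm1_eq0 w0) addr0.
(* [v] is the convex combination of the normalized [y] and [w] with weights [norm1 y] and [norm1 w];
   extremality makes both equal to [v]. *)
have Qn u : feasible_cone A B d x u -> norm1 u != 0 -> Q ((norm1 u)^-1 *: u).
  move=> Ku u0; apply/QE; split.
    by apply: feasible_coneZ; rewrite // invr_ge0 norm1_ge0.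
  by rewrite norm1Z ger0_norm ?invr_ge0 ?norm1_ge0 // mulVf.
have wE : 1 - norm1 y = norm1 w by rewrite -yw1 addrAC subrr add0r.
have [||yv wv] := vext _ _ (norm1 y) (Qn y Ky y0) (Qn w Kw w0).
- rewrite lt_neqAle eq_sym y0 norm1_ge0 /= -subr_gt0 wE.
  by rewrite lt_neqAle eq_sym w0 norm1_ge0.
- by rewrite wE !scalerA !divff // !scale1r.
exists (norm1 y), (norm1 w); split; rewrite ?norm1_ge0 //.
  by rewrite -yv scalerA divff // scale1r.
by rewrite -wv scalerA divff // scale1r.
Qed.

Lemma feasible_cone_slope (R : realType) (m p n : nat) (A : 'M[int]_(m, n))
    (B : 'M[int]_(p, n)) (b : 'cV[int]_m) (d : 'cV[int]_p) (c : 'cV[int]_n)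
    (x g z : 'cV[R]_n) :
  zero_one_polytope (@polyhedron R m p n A B b d) ->
  extreme_point (polyhedron A B b d) x -> steepest_edge A B d c x g ->
  feasible_cone A B d x z ->
  objective c g / norm1 g * norm1 z <= objective c z.
Proof.
move=> P01 xext [_ steep] Kz.
have n1 := norm1_feasible_cone P01 xext.
pose f : 'rV[R]_n :=
  (map_mx intr c)^T - (objective c g / norm1 g) *: \row_j (1 - 2 * x j 0).
have fE y : feasible_cone A B d x y ->
    (f *m y) 0 0 = objective c y - objective c g / norm1 g * norm1 y.
  move=> Ky; rewrite (n1 y) // /f mulmxBl -scalemxAl mxE.
  by rewrite [X in _ + X]mxE [X in - X]mxE.
rewrite -subr_ge0 -fE //; apply: (feasible_cone_ge0 n1 _ Kz) => h edge_h.
have [Kh h0 _] := edge_h; rewrite fE // subr_ge0 -ler_pdivlMr ?norm1_gt0 //.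
exact: steep.
Qed.

(* Otherwise half the step would improve more, the objective being minimized. *)
Lemma greatest_improvement_le0 (R : realType) (m p n : nat)
    (A : 'M[int]_(m, n)) (B : 'M[int]_(p, n)) (b : 'cV[int]_m)
    (d : 'cV[int]_p) (c : 'cV[int]_n) (x g : 'cV[R]_n) (alpha : R) :
  polyhedron A B b d x -> greatest_improvement A B b d c x g alpha ->
  alpha * objective c g <= 0.
Proof.
move=> [Ax Bx] [[Cg a0 [Aa Ba]] best].
have half : circuit_step A B b d x g (alpha / 2).
  have Ag : map_mx intr A *m (alpha *: g) = 0.
    by apply: (addrI (map_mx intr A *m x)); rewrite -mulmxDr Aa addr0.
  split; rewrite ?divr_gt0 //; split=> [|i].
    by rewrite mulrC -scalerA mulmxDr -scalemxAr Ag scaler0 addr0.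
  by move: (Bx i) (Ba i); rewrite !mulmx_line; lra.
by have := best _ _ half; rewrite !objectiveZ; lra.
Qed.

(** * The approximation guarantee *)

Unset Implicit Arguments.

Theorem theorem4 (R : realType) (m p n : nat)
    (A : 'M[int]_(m, n)) (B : 'M[int]_(p, n)) (b : 'cV[int]_m) (d : 'cV[int]_p)
    (c : 'cV[int]_n)
    (rankA : \rank (map_mx intr A : 'M[R]_(m, n)) = m)
    (rankAB : \rank (col_mx (map_mx intr A) (map_mx intr B) : 'M[R]_(m + p, n)) = n)
    (P01 : zero_one_polytope (@polyhedron R m p n A B b d))
    (x : 'cV[R]_n) (hx : extreme_point (polyhedron A B b d) x)
    (g : 'cV[R]_n) (hg : steepest_edge A B d c x g)
    (alpha : R) (halpha : maximal_step (polyhedron A B b d) x g alpha) :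
  approx_greatest_improvement A B b d c n%:R x (alpha *: g).
Proof.
have [edge_g _] := hg.
have [a0 Pa _] := halpha.
have [_ g0 _] := edge_g.
have v0 : alpha *: g != 0 by rewrite scaler_eq0 negb_or gt_eqF.
have yext := maximal_step_edge_extreme hx.1 edge_g halpha.
(* Both ends of the step are vertices, hence 0/1 vectors. *)
have vint i : {k : int | (alpha *: g) i 0 = k%:~R /\ (`|k| <= 1)%N}.
  apply: cid; have := P01.2 _ yext i; rewrite [(x + _) i 0]mxE.
  by case: (P01.2 _ hx i) => -> [] vE;
    [exists 0 | exists 1 | exists (-1) | exists 0]; split=> //; lra.
have [z [vz z_le1]] : exists z : 'cV[int]_n,
    alpha *: g = map_mx intr z /\ forall i, (`|z i 0%R| <= 1)%N.
  exists (\col_i sval (vint i)); split=> [|i].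
    by apply/colP => i; rewrite [RHS]mxE [in RHS]mxE; case: (svalP (vint i)).
  by rewrite mxE; case: (svalP (vint i)).
have [j vj] : exists j, (alpha *: g) j 0 != 0.
  apply: contrapT => vj; case/eqP: v0; apply/colP => j; rewrite [RHS]mxE.
  by apply: contrapT => /eqP ?; apply: vj; exists j.
have zj : `|z j 0%R|%N = 1%N.
  apply/eqP; rewrite eqn_leq z_le1 absz_gt0.
  by move: vj; rewrite vz mxE intr_eq0.
have n_gt0 : (0 < n%:R :> R) by rewrite ltr0n; case: (n) (j) => [[]|].
have v1 : 1 <= norm1 (alpha *: g).
  rewrite /norm1 (bigD1 j) //= vz mxE -intr_norm -abszE zj lerDl.
  exact: sumr_ge0.
split.
  (* The displacement itself, with step length 1, is the co-prime circuit: it is integral and its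
     entry [j] is 1 or -1. *)
  exists (alpha *: g), 1; rewrite scale1r; split=> //.
  split=> //; last by rewrite scale1r.
  split.
    have [_ Ag gmin] := edge_direction_circuit edge_g.
    split=> //; first by rewrite -scalemxAr Ag scaler0.
    move=> y y0 Ay; apply: contra (gmin y y0 Ay) => /proper_sub_trans; apply.
    apply/fintype.subsetP => i; rewrite !inE -scalemxAr mxE mulf_eq0 negb_or.
    by case/andP.
  exists z; split=> //; apply/eqP; rewrite -dvdn1 -[X in (_ %| X)%N]zj.
  by rewrite (bigD1 j) //= dvdn_gcdl.
move=> gs alphas best; have le0 := greatest_improvement_le0 hx.1 best.
have [[_ as0 Pw] _] := best.
set sigma := objective c g / norm1 g.
have Kw : feasible_cone A B d x (alphas *: gs).
  by have := feasible_cone_sub hx.1 Pw; rewrite addrAC subrr add0r.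
(* Both ends lie in the unit cube, so each coordinate moves by at most 1. *)
have w_le : norm1 (alphas *: gs) <= n%:R.
  rewrite /norm1 -[n in n%:R]card_ord -sum1_card natr_sum.
  apply: ler_sum => i _; rewrite ler_norml.
  have := zero_one_polytope_bounds i P01 Pw.
  by rewrite [(x + _) i 0]mxE; case: (P01.2 _ hx i) => ->; lra.
have g1 := norm1_gt0 g0.
have slope_v : alpha * objective c g = sigma * norm1 (alpha *: g).
  by rewrite norm1Z gtr0_norm // /sigma mulrCA divfK // gt_eqF.
have slope_w := feasible_cone_slope P01 hx hg Kw.
rewrite -/sigma objectiveZ in slope_w.
rewrite ler_pdivrMl // !objective_line slope_v.
have [s0|s0] := leP sigma 0.
  have sw : sigma * n%:R <= sigma * norm1 (alphas *: gs) by exact: ler_wnM2l.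
  have sv : sigma * n%:R * norm1 (alpha *: g) <= sigma * n%:R * 1.
    by apply: ler_wnM2l => //; rewrite mulr_le0_ge0 // ltW.
  by move: slope_w sw sv; lra.
(* With a positive slope, a displacement in the cone that does not increase the objective must be
   zero, unlike a circuit step. *)
have w0 : norm1 (alphas *: gs) = 0.
  apply/eqP; rewrite eq_le norm1_ge0 andbT -(pmulr_rle0 _ s0).
  exact: le_trans slope_w le0.
have [[[gs0 _ _] _] _ _] := best.1.
by move/eqP: (norm1_eq0 w0); rewrite scaler_eq0 (gt_eqF as0) (negbTE gs0).
Qed.
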